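(* Let $I,S,C\subseteq G$ be pairwise disjoint and suppose $I$ is AD-separated from $S$ by $C$. Then $X_I$ is epistemically h-irrelevant to $X_S$ conditional on $X_C$ with respect to the irrelevant natural extension, i.e. $$\underline{E}^{\mathrm{irr}}_G\big(f(X_S)\mid B_S,x_C,B_I\big)=\underline{E}^{\mathrm{irr}}_G\big(f(X_S)\mid B_S,x_C\big)$$ for all $f\in\mathcal{L}(\mathcal{X}_S)$, all nonempty $B_S\subseteq\mathcal{X}_S$, all $x_C\in\mathcal{X}_C$ and all nonempty $B_I\subseteq\mathcal{X}_I$.
   Context: Setting: $G$ is a finite set of nodes forming a DAG; node $s$ carries a variable $X_s$ with finite nonempty state space $\mathcal{X}_s$; $\mathcal{X}_S=\times_{s\in S}\mathcal{X}_s$; $\mathcal{L}(\mathcal{X}_S)$: real-valued functions on $\mathcal{X}_S$. $P(s)$: parents; $s\sqsubset v$: directed path of positive length from $s$ to $v$; $D(s)=\{v:s\sqsubset v\}$; $N(s)=G\setminus(\{s\}\cup D(s))$. Local models: nonempty closed convex sets $\mathcal{M}_{s\mid x_{P(s)}}$ of probability mass functions on $\mathcal{X}_s$. Full conditional probability measure on finite $\Omega$: $(A,B)\mapsto P(A\mid B)$ ($B\ne\emptyset$) with (F1) $P(\cdot\mid B)$ a probability measure, $P(B\mid B)=1$; (F2) $P(A\cap C\mid B)=P(A\mid C\cap B)P(C\mid B)$ if $C\cap B\ne\emptyset$. Irrelevant natural extension $\mathcal{F}^{\mathrm{irr}}_G$: all full conditional probability measures $P$ on $\mathcal{X}_G$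 with $P(X_s\mid x_{N(s)})\in\mathcal{M}_{s\mid x_{P(s)}}$ for all $s,x_{N(s)}$. For nonempty $B\subseteq\mathcal{X}_G$, $\underline{E}^{\mathrm{irr}}_G(f(X_S)\mid B)=\inf\{\sum_{z_S}f(z_S)P(z_S\mid B):P\in\mathcal{F}^{\mathrm{irr}}_G\}$; a conditioning expression $(B_S,x_C,B_I)$ is the event $\{z_G: z_S\in B_S, z_C=x_C, z_I\in B_I\}$. AD-separation: a path $s_1,\dots,s_n$ ($n\ge1$; consecutive nodes joined by an edge in either direction) is blocked by $C$ if (B1) $s_1\in C$; or (B2) some $1<i<n$ has $s_i\to s_{i+1}$ and $s_i\in C$; or (B3) some $1<i<n$ has $s_{i-1}\to s_i\leftarrow s_{i+1}$, $s_i\notin C$ and $D(s_i)\cap C=\emptyset$; or (B4) $s_n\in C$. $I$ is AD-separated from $S$ by $C$ if every path from any node of $I$ to any node of $S$ is blocked by $C$. *)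

(* Defs.v *)
From Stdlib Require Import Reals ClassicalEpsilon.
From HB Require Import structures.
From mathcomp Require Import all_boot.

Set Implicit Arguments.
Unset Strict Implicit.
Unset Printing Implicit Defensive.

Local Open Scope R_scope.
HB.instance Definition _ := Monoid.isComLaw.Build R 0 Rplus
  (fun a b c => esym (Rplus_assoc a b c)) Rplus_comm Rplus_0_l.

Section Defs.
Local Open Scope R_scope.
Variable G : finType.
(* e s v  <->  edge s -> v, i.e. s is a parent of v *)
Variable e : rel G.
Variable X : G -> finType.

Definition sqsub (s v : G) : bool := [exists w, e s w && connect e w v].
Definition dag : Prop := forall s, ~~ sqsub s s.
Definition par (s : G) : {set G} := [set p | e p s].
Definition desc (s : G) : {set G} := [set v | sqsub s v].
Definition nondesc (s : G) : {set G} := ~: (s |: desc s).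

Definition XS (S : {set G}) : finType := {dffun forall t : {t : G | t \in S}, X (val t)}.
Definition Omega : finType := {dffun forall s : G, X s}.
Definition proj (S : {set G}) (z : Omega) : XS S := [ffun t => z (val t)].

Definition is_pmf (T : finType) (p : T -> R) : Prop :=
  (forall a, (0 <= p a)) /\ \big[Rplus/0]_(a : T) p a = 1.

Definition credal_set (T : finType) (K : (T -> R) -> Prop) : Prop :=
  [/\ (forall p, K p -> is_pmf p),
      (exists p, K p),
      (forall p q (l : R), K p -> K q -> (0 <= l <= 1) ->
          K (fun a => l * p a + (1 - l) * q a))
    & (forall (u : nat -> T -> R) (p : T -> R),
          (forall n, K (u n)) -> (forall a, Un_cv (fun n => u n a) (p a)) -> K p)].

Definition local_models (M : forall s : G, XS (par s) -> (X s -> R) -> Prop) : Prop :=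
  forall s (xp : XS (par s)), credal_set (M s xp).

(* full conditional probability measures on Omega: P A B = P(A | B) *)
Definition full_cond_prob (P : {set Omega} -> {set Omega} -> R) : Prop :=
  (forall B, B != set0 ->
     [/\ (forall A, (0 <= P A B)),
         P setT B = 1,
         (forall A A' : {set Omega}, [disjoint A & A'] -> P (A :|: A') B = (P A B + P A' B))
       & P B B = 1]) /\
  (forall A C B, C :&: B != set0 -> P (A :&: C) B = (P A (C :&: B) * P C B)).

Definition nd_event (s : G) (x : Omega) : {set Omega} :=
  [set z : Omega | [forall t, (t \in nondesc s) ==> (z t == x t)]].

Definition F_irr (M : forall s : G, XS (par s) -> (X s -> R) -> Prop)
  (P : {set Omega} -> {set Omega} -> R) : Prop :=
  full_cond_prob P /\
  forall (s : G) (x : Omega),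
    M s (proj (par s) x) (fun a : X s => P [set z : Omega | z s == a] (nd_event s x)).

Inductive ereal := EFin of R | EPInf | ENInf.

Definition is_glb (A : R -> Prop) (l : R) : Prop :=
  (forall r, A r -> (l <= r)) /\ (forall m, (forall r, A r -> (m <= r)) -> (m <= l)).

Definition einf (A : R -> Prop) : ereal :=
  match excluded_middle_informative (exists r, A r) with
  | right _ => EPInf
  | left _ =>
    match excluded_middle_informative (exists m, forall r, A r -> (m <= r)) with
    | right _ => ENInf
    | left _ => EFin (epsilon (inhabits 0) (is_glb A))
    end
  end.

Definition lowerE (M : forall s : G, XS (par s) -> (X s -> R) -> Prop)
  (S : {set G}) (f : XS S -> R) (B : {set Omega}) : ereal :=
  einf (fun r => exists P, F_irr M P /\
          r = \big[Rplus/0]_(y : XS S) (f y * P [set z : Omega | proj S z == y] B)).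

Definition cond3 (S C I : {set G}) (BS : {set XS S}) (xC : XS C) (BI : {set XS I})
  : {set Omega} :=
  [set z : Omega | [&& proj S z \in BS, proj C z == xC & proj I z \in BI]].
Definition cond2 (S C : {set G}) (BS : {set XS S}) (xC : XS C) : {set Omega} :=
  [set z : Omega | (proj S z \in BS) && (proj C z == xC)].

(* AD-separation.  A path s_1, ..., s_n (n >= 1) is represented by its first
   node s0 and the rest p, i.e. as the sequence q := s0 :: p, indexed from 0:
   s_(i+1) = nth s0 q i.  Paths consist of distinct nodes (uniq). *)
Definition is_path (s0 : G) (p : seq G) : Prop :=
  let q := s0 :: p in
  uniq q /\ forall i, (i.+1 < size q)%N ->
    e (nth s0 q i) (nth s0 q i.+1) || e (nth s0 q i.+1) (nth s0 q i).

Definition blocked (C : {set G}) (s0 : G) (p : seq G) : Prop :=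
  let q := s0 :: p in
  let n := size q in
  (* (B1) *) nth s0 q 0 \in C \/
  (* (B2) *) (exists i, (0 < i)%N /\ (i.+1 < n)%N /\
                e (nth s0 q i) (nth s0 q i.+1) /\ nth s0 q i \in C) \/
  (* (B3) *) (exists i, (0 < i)%N /\ (i.+1 < n)%N /\
                e (nth s0 q i.-1) (nth s0 q i) /\ e (nth s0 q i.+1) (nth s0 q i) /\
                nth s0 q i \notin C /\ desc (nth s0 q i) :&: C = set0) \/
  (* (B4) *) nth s0 q n.-1 \in C.

Definition AD_separated (C I S : {set G}) : Prop :=
  forall (s0 : G) (p : seq G), is_path s0 p ->
    s0 \in I -> last s0 p \in S -> blocked C s0 p.
End Defs.

(* Main.v *)
Require Import Defs.
From Stdlib Require Import Reals Lra ClassicalEpsilon FunctionalExtensionality PropExtensionality.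
From HB Require Import structures.
From mathcomp Require Import all_boot.

(** AD-separation yields disjoint sets [U] (closed under parents, containing [I])
and [V] (containing [S]) such that [C] is covered by them and every parent of a
node of [V] lies in [V] or in [C :&: U].  Given [P] in the irrelevant natural
extension and events [B1], [B2] about [X_U] that fix the same value on [C :&: U],
one grafts the [V]-behaviour of [P] given [B1] onto a network that is locally a
plain Bayesian network elsewhere, so as to obtain [P'] in the extension with
[P' (. | F, B2) = P (. | F, B1)] for all [V]-events.  Zero probabilities are
handled by writing full conditional measures as limits of conditionals of
strictly positive weights.  Whenever some node [c] of [C :&: U] has the wrong
value, the nodes of [V] below [c] go back to their local models and only the
marginal of [P] on the remaining nodes of [V] is kept; this is what keeps the
grafted measure epistemically irrelevant at the nodes of [U] above [V]. *)

Set Implicit Arguments.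
Unset Strict Implicit.
Unset Printing Implicit Defensive.

(** * Splitting the network along an AD-separation *)

Section Graph.
Variables (G : finType) (e : rel G).
Hypothesis Hdag : dag e.

Definition ancestral (A : {set G}) := forall p t, e p t -> t \in A -> p \in A.

Lemma sqsubP s v : reflect (exists2 w, e s w & connect e w v) (sqsub e s v).
Proof. by apply: (iffP existsP) => [[w /andP[? ?]]|[w ? ?]]; exists w => //; apply/andP. Qed.

Lemma edge_sqsub s v : e s v -> sqsub e s v.
Proof. by move=> h; apply/sqsubP; exists v. Qed.

Lemma sqsub_connect s v : sqsub e s v -> connect e s v.
Proof. by case/sqsubP=> w /connect1 h; apply: connect_trans. Qed.

Lemma connect_sqsub_trans u s v : sqsub e u s -> connect e s v -> sqsub e u v.
Proof. by case/sqsubP=> w h1 h2 h3; apply/sqsubP; exists w => //; apply: connect_trans h3. Qed.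

Lemma edge_connectF w j : e w j -> connect e j w = false.
Proof.
move=> h; apply/negP=> h'; case/negP: (Hdag w); apply/sqsubP; by exists j.
Qed.

Lemma edge_asym w j : e w j -> e j w = false.
Proof. by move=> h; apply/negP=> /connect1; rewrite (edge_connectF h). Qed.

Lemma ancestral_connect A c v : ancestral A -> connect e c v -> v \in A -> c \in A.
Proof.
move=> hA /connectP[p hp ->]; elim: p c hp => //= w p IH c /andP[h hp] hl.
by apply: hA h _; apply: IH.
Qed.

Lemma nondesc_ancestral s : ancestral (nondesc e s).
Proof.
move=> p t hpt; rewrite !inE !negb_or => /andP[hts hst].
have hps : p != s by apply: contraNneq hst => <-; apply: edge_sqsub.
rewrite hps /=; apply: contra hst => h.
exact: connect_sqsub_trans h (connect1 hpt).
Qed.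

Lemma par_nondesc s p : e p s -> p \in nondesc e s.
Proof.
move=> h; rewrite !inE negb_or; apply/andP; split.
  by apply: contraTneq h => ->; apply/negP => /edge_sqsub; apply/negP.
by apply/negP => /sqsub_connect; rewrite (edge_connectF h).
Qed.

Lemma ancestral_extension A :
  ancestral A -> A != setT -> exists t, [/\ t \notin A & forall p, e p t -> p \in A].
Proof.
move=> hA; rewrite -subTset => /subsetPn[t0 _ ht0].
pose anc t := [set p | connect e p t].
case: (@arg_minnP _ t0 (fun t => t \notin A) (fun t => #|anc t|) ht0) => t ht hmin.
exists t; split=> // p hpt; apply/negPn/negP => hp.
suff: #|anc p| < #|anc t| by rewrite ltnNge hmin.
apply: proper_card; apply/properP; split.
  by apply/subsetP=> q; rewrite !inE => h; apply: connect_trans h (connect1 hpt).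
by exists t; rewrite inE ?connect0 // (edge_connectF hpt).
Qed.

Variables (I S C : {set G}).
Hypotheses (HIC : [disjoint I & C]) (HSC : [disjoint S & C]).
Hypothesis Hsep : AD_separated e C I S.

Let ancC w := [exists c in C, connect e w c].

Definition open_step w v := (e w v && (w \notin C)) || (e v w && ancC w).

(* [connect open_step w s] is an unblocked walk from [w] to [s] that may only enter
   a node through a child when that node leads to [C]; shortening such a walk to a
   simple path keeps it unblocked, which fails for unblocked walks in general. *)
Definition open_region : {set G} := [set w | [exists s in S, connect open_step w s]].

Definition blocking a b c := (e b c && (b \in C)) || [&& e a b, e c b & ~~ ancC b].

Definition open_path (s0 : G) (p : seq G) :=
  forall i, i.+2 < size (s0 :: p) ->
    ~~ blocking (nth s0 (s0 :: p) i) (nth s0 (s0 :: p) i.+1) (nth s0 (s0 :: p) i.+2).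

Lemma open_path_not_blocked s0 p :
  s0 \in I -> last s0 p \in S -> open_path s0 p -> ~ blocked e C s0 p.
Proof.
move=> hI hS hop [|[|[|]]].
- by move=> /= h; move: (disjointFr HIC hI); rewrite h.
- case=> [[|i] [// _ [hi [h1 h2]]]].
  have := hop i hi; rewrite /blocking; move: h1 h2 => /= -> ->. by [].
- case=> [[|i] [// _ [hi [h1 [h2 [h3 h4]]]]]].
  have := hop i hi; rewrite /blocking; move: h1 h2 h3 h4 => /= -> -> h3 h4.
  rewrite negb_or /= negbK => /andP[_ /existsP[c /andP[hc hcon]]].
  case/connectP: hcon => [[|x q]] /= hq hl.
    by move: h3; rewrite -hl hc.
  have : c \in desc e (nth s0 p i) :&: C.
    rewrite !inE hc andbT; apply/sqsubP; case/andP: hq => h5 h6; exists x => //.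
    by apply/connectP; exists q.
  by rewrite h4 inE.
- by rewrite /= -last_nth => h; move: (disjointFr HSC hS); rewrite h.
Qed.

Lemma open_path_cons j w p : open_path w p ->
  (p <> [::] -> ~~ blocking j w (head w p)) -> open_path j (w :: p).
Proof.
move=> h1 h2 [|i] hi.
  by case: p hi h2 {h1} => //= x p _; apply.
have hi' : i.+2 < size (w :: p) by [].
have hi1 : i.+1 < size (w :: p) by apply: ltnW.
by have := h1 i hi'; rewrite !(set_nth_default j w) //; apply: ltnW.
Qed.

(* Strengthened so that the path can still be prolonged by any child of [w]: the
   last clause keeps it simple, the one before it keeps [w] from blocking. *)
Definition descends w := exists p,
  [/\ is_path e w p, last w p \in S, open_path w p,
      (p <> [::] -> ~~ (e w (head w p) && (w \in C)))
    & forall x, x \in w :: p -> (x \in open_region) || connect e x w].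

Lemma is_path_cons j w p : is_path e w p -> e j w || e w j -> j \notin w :: p ->
  is_path e j (w :: p).
Proof.
move=> [hu hadj] hjw hj; split; first by rewrite /= hj.
move=> [|i] hi //; have hi' : i.+1 < size (w :: p) by [].
have := hadj i hi'. rewrite !(set_nth_default j w) //; exact: ltnW.
Qed.

Lemma open_step_path w p : path open_step w p -> uniq (w :: p) -> last w p \in S ->
  is_path e w p /\ open_path w p.
Proof.
elim: p w => [|v p IH] w /=.
  by move=> _ _ _; split=> //; split=> // [[|i]].
case/andP=> hwv hp /andP[hw hu] hl.
have [h1 h2] := IH v hp hu hl; split.
  apply: is_path_cons => //.
  by case/orP: hwv => /andP[-> _]; rewrite ?orbT.
apply: open_path_cons => //.
case: p hp {IH hw hu hl h1 h2} => //= u p /andP[hvu _] _.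
rewrite /blocking negb_or !negb_and negbK.
case/orP: hvu => /andP[h1 h2].
  by rewrite h2 (edge_asym h1) !orbT.
by rewrite (edge_asym h1) h2 !orbT.
Qed.

Lemma open_region_descends w : w \in open_region -> descends w.
Proof.
rewrite inE => /existsP[s /andP[hs /connectP[p0 hp0 hl0]]].
case/shortenP: hp0 hl0 => p hp hu _ hl.
have hlS : last w p \in S by rewrite -hl.
have [h1 h2] := open_step_path hp hu hlS.
exists p; split=> //.
  case: p hp {hu hl hlS h1 h2} => //= v p /andP[hwv _] _.
  case/orP: hwv => /andP[h1 h2]; first by rewrite (negbTE h2) andbF.
  by rewrite (edge_asym h1).
move=> x hx; apply/orP; left; rewrite inE; apply/existsP; exists s; rewrite hs /=.
case/splitPl: hx hp hl {hu hlS h1 h2} => p1 p2 <-; rewrite cat_path last_cat => /andP[_ h] hl.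
by apply/connectP; exists p2.
Qed.

Lemma descends_child w j : descends w -> e w j -> descends j.
Proof.
move=> [p [h1 h2 h3 h4 h5]] hwj.
have [hj|hj] := boolP (j \in open_region); first exact: open_region_descends.
have hjp : j \notin w :: p.
  by apply: contra hj => /h5; rewrite (edge_connectF hwj) orbF.
exists (w :: p); split=> //.
- by apply: is_path_cons => //; rewrite hwj orbT.
- apply: open_path_cons => // hp; rewrite /blocking (edge_asym hwj) orbF.
  exact: h4.
- by move=> _ /=; rewrite (edge_asym hwj).
- move=> x; rewrite in_cons => /orP[/eqP ->|/h5 /orP[->//|h]]; first by rewrite connect0 orbT.
  by rewrite (connect_trans h (connect1 hwj)) orbT.
Qed.

Lemma descends_connect w j : descends w -> connect e w j -> descends j.
Proof.
move=> h /connectP[p hp ->]; elim: p w h hp => //= v p IH w h /andP[h1 h2].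
by apply: IH h2; apply: descends_child h1.
Qed.

Lemma descends_notin w : w \in I -> ~ descends w.
Proof.
move=> hI [p [h1 h2 h3 _ _]]; exact: (open_path_not_blocked hI h2 h3 (Hsep h1 hI h2)).
Qed.

Lemma open_region_step w v : open_step w v -> v \in open_region -> w \in open_region.
Proof.
rewrite !inE => h /existsP[s /andP[hs hc]]; apply/existsP; exists s; rewrite hs.
exact: connect_trans (connect1 h) hc.
Qed.

Lemma AD_separated_split : exists U V : {set G},
  [/\ [disjoint U & V], ancestral U, 
     forall p v, e p v -> v \in V -> (p \in V) || (p \in C :&: U),
     I \subset U & S \subset V] /\ C \subset U :|: V.
Proof.
pose V := open_region; pose U := [set w | ~~ [exists v in V, connect e v w]].
have hCUV : C \subset U :|: V.
  apply/subsetP=> c hc; rewrite inE orbC; case: (boolP (c \in V)) => //= hcV.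
  rewrite inE; apply: contra hcV => /existsP[v /andP[hv /connectP[p hp hl]]].
  have : ancC c by apply/existsP; exists c; rewrite hc /= connect0.
  rewrite {}hl {hc}; elim: p v hv hp => //= w p IH v hv /andP[hvw hp] hA.
  apply: (IH w) => //; apply: open_region_step hv; rewrite /open_step hvw /=.
  apply/orP; right; case/existsP: hA => c' /andP[hc' hc'']; apply/existsP; exists c'; rewrite hc'.
  by apply: connect_trans hc''; apply/connectP; exists p.
exists U, V; split=> //; split.
- apply/pred0P=> w /=; rewrite [in w \in U]inE; apply/negbTE; rewrite negb_and negbK.
  case: (boolP (w \in V)) => h; last by rewrite orbT.
  by rewrite orbF; apply/existsP; exists w; rewrite h connect0.
- move=> p t hpt; rewrite !inE; apply: contra => /existsP[v /andP[h1 h2]].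
  by apply/existsP; exists v; rewrite h1 (connect_trans h2 (connect1 hpt)).
- move=> p v hpv hv; case: (boolP (p \in C)) => hpC; last first.
    by rewrite (open_region_step _ hv) // /open_step hpv hpC.
  by rewrite in_setI hpC; move/subsetP: hCUV => /(_ p hpC); rewrite in_setU orbC.
- apply/subsetP=> i hi; rewrite inE; apply/negP => /existsP[v /andP[hv hc]].
  exact: (descends_notin hi (descends_connect (open_region_descends hv) hc)).
- by apply/subsetP=> s hs; rewrite inE; apply/existsP; exists s; rewrite hs connect0.
Qed.
End Graph.

(** * Full conditional probabilities as limits of positive weights *)

HB.instance Definition _ := Monoid.isComLaw.Build R (IZR 1) Rmult
  (fun a b c => esym (Rmult_assoc a b c)) Rmult_comm Rmult_1_l.
HB.instance Definition _ := Monoid.isMulLaw.Build R (IZR 0) Rmult Rmult_0_l Rmult_0_r.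
HB.instance Definition _ := Monoid.isAddLaw.Build R Rmult Rplus
  Rmult_plus_distr_r Rmult_plus_distr_l.

Section Limits.
Local Open Scope R_scope.

Lemma Un_cv_ext (u v : nat -> R) l : (forall n, u n = v n) -> Un_cv u l -> Un_cv v l.
Proof. by move=> huv hu eps /hu[N hN]; exists N => n; rewrite -huv; apply: hN. Qed.

Lemma Un_cv_const l : Un_cv (fun=> l) l.
Proof. by move=> eps heps; exists 0%N => n _; rewrite /Rdist Rminus_diag Rabs_R0. Qed.

Lemma Un_cv_reindex (u : nat -> R) (phi : nat -> nat) l :
  (forall n, (n <= phi n)%N) -> Un_cv u l -> Un_cv (fun n => u (phi n)) l.
Proof.
move=> hphi hu eps /hu[N hN]; exists N => n /leP hn; apply: hN; apply/leP.
exact: leq_trans hn (hphi n).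
Qed.

Lemma Un_cv_div (u v : nat -> R) l m : m <> 0 ->
  Un_cv u l -> Un_cv v m -> Un_cv (fun n => u n / v n) (l / m).
Proof.
move=> hm hu hv; apply: CV_mult => //; apply: (@continuity_seq Rinv) => //.
apply: (@continuity_pt_inv id) => //; apply: derivable_continuous_pt; exact: derivable_pt_id.
Qed.

Lemma exists_subsequence_cv (u : nat -> R) : (forall n, 0 <= u n <= 1) ->
  exists2 phi, (forall n : nat, (n <= phi n)%N) & exists l, Un_cv (fun n => u (phi n)) l.
Proof.
move=> hu; have [l hl] := Bolzano_Weierstrass _ _ (compact_P3 0 1) hu.
have H n : exists p, (n <= p)%N /\ Rabs (u p - l) < RinvN n.
  have [|p [/leP hp hV]] := hl (disc l (RinvN n)) n; first by exists (RinvN n) => x.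
  by exists p.
pose phi n := proj1_sig (ClassicalEpsilon.constructive_indefinite_description _ (H n)).
have hphi n : (n <= phi n)%N /\ Rabs (u (phi n) - l) < RinvN n.
  by rewrite /phi; case: ClassicalEpsilon.constructive_indefinite_description.
exists phi => [n|]; first by case: (hphi n).
exists l => eps heps; have [N hN] := RinvN_cv heps; exists N => n hn.
have := hN n hn; rewrite /Rdist Rminus_0_r Rabs_pos_eq; last exact/Rlt_le/cond_pos.
by apply: Rlt_trans; case: (hphi n).
Qed.

Lemma exists_diagonal_cv (T : finType) (u : nat -> T -> R) : (forall n a, 0 <= u n a <= 1) ->
  exists2 phi, (forall n : nat, (n <= phi n)%N)
    & exists l : T -> R, forall a, Un_cv (fun n => u (phi n) a) (l a).
Proof.
move=> hu.
suff H (s : seq T) : exists2 phi, (forall n : nat, (n <= phi n)%N)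
    & forall a, a \in s -> exists l, Un_cv (fun n => u (phi n) a) l.
  have [phi hphi hl] := H (enum T); exists phi => //.
  have h a : exists l, Un_cv (fun n => u (phi n) a) l by apply: hl; rewrite mem_enum.
  exists (fun a => proj1_sig (ClassicalEpsilon.constructive_indefinite_description _ (h a))) => a.
  by case: ClassicalEpsilon.constructive_indefinite_description.
elim: s => [|a s [phi hphi hs]]; first by exists id.
have [psi hpsi [l hl]] := exists_subsequence_cv (fun n => hu (phi n) a).
exists (phi \o psi) => [n|b]; first exact: leq_trans (hpsi n) (hphi _).
rewrite in_cons => /orP[/eqP ->|/hs[m hm]]; first by exists l.
by exists m; apply: (Un_cv_reindex hpsi hm).
Qed.

Section Mass.
Variable T : finType.
Implicit Types (w : T -> R) (A B : {set T}).

Definition mass w A := \big[Rplus/0]_(z in A) w z.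

Lemma sum_ge0 (J : finType) (Q : pred J) (F : J -> R) :
  (forall i, Q i -> 0 <= F i) -> 0 <= \big[Rplus/0]_(i | Q i) F i.
Proof. by move=> hF; apply: big_ind => [|x y|//]; lra. Qed.

Lemma sum_gt0 (J : finType) (Q : pred J) (F : J -> R) j : Q j ->
  (forall i, Q i -> 0 < F i) -> 0 < \big[Rplus/0]_(i | Q i) F i.
Proof.
move=> hj hF; rewrite (bigD1 j) //=; apply: Rplus_lt_le_0_compat; first exact: hF.
by apply: sum_ge0 => i /andP[/hF/Rlt_le].
Qed.

Lemma prod_gt0 (J : finType) (Q : pred J) (F : J -> R) :
  (forall i, Q i -> 0 < F i) -> 0 < \big[Rmult/1]_(i | Q i) F i.
Proof. by move=> hF; apply: big_ind => [|x y|//]; [lra | exact: Rmult_lt_0_compat]. Qed.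

Lemma mass_ge0 w A : (forall z, 0 < w z) -> 0 <= mass w A.
Proof. by move=> hw; apply: sum_ge0 => z _; apply/Rlt_le. Qed.

Lemma mass_gt0 w A : (forall z, 0 < w z) -> A != set0 -> 0 < mass w A.
Proof. by move=> hw /set0Pn[z hz]; apply: (sum_gt0 hz). Qed.

Lemma massU w A B : [disjoint A & B] -> mass w (A :|: B) = mass w A + mass w B.
Proof. by move=> h; rewrite /mass -bigU //; apply: eq_bigl => z; rewrite !inE. Qed.

Lemma disjointID A B : [disjoint A :&: B & A :\: B].
Proof. by rewrite -setI_eq0; apply/eqP/setP=> z; rewrite !inE; case: (z \in B); rewrite ?andbF. Qed.

Lemma mass_le w A B : (forall z, 0 < w z) -> A \subset B -> mass w A <= mass w B.
Proof.
move=> hw hAB; rewrite -(setID B A) massU ?disjointID //.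
by rewrite (setIidPr hAB); have := mass_ge0 (B :\: A) hw; lra.
Qed.

Lemma mass0 w : mass w set0 = 0.
Proof. by rewrite /mass big_set0. Qed.

Definition cond_ratio w A B := mass w (A :&: B) / mass w B.

Lemma cond_ratio_bounds w A B : (forall z, 0 < w z) -> 0 <= cond_ratio w A B <= 1.
Proof.
move=> hw; rewrite /cond_ratio; case: (eqVneq B set0) => [->|hB].
  by rewrite setI0 mass0; lra.
have hB0 := mass_gt0 hw hB; have h1 := mass_ge0 (A :&: B) hw.
have h2 := mass_le hw (subsetIr A B).
split; first by apply: Rle_mult_inv_pos.
apply: (Rmult_le_reg_r (mass w B)) => //.
suff -> : mass w (A :&: B) / mass w B * mass w B = mass w (A :&: B) by lra.
by field; lra.
Qed.
End Mass.
End Limits.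

Section FullConditional.
Variables (G : finType) (X : G -> finType).
Local Notation Om := (Omega X).
Implicit Types (w : Om -> R) (P : {set Om} -> {set Om} -> R) (A B : {set Om}).
Local Open Scope R_scope.

Lemma exists_full_cond_limit (w : nat -> Om -> R) : (forall n z, 0 < w n z) ->
  exists2 phi, (forall n : nat, (n <= phi n)%N)
    & exists2 P, full_cond_prob P
      & forall A B, Un_cv (fun n => cond_ratio (w (phi n)) A B) (P A B).
Proof.
move=> hw.
have [phi hphi [l hl]] := exists_diagonal_cv
  (fun n (AB : {set Om} * {set Om}) => cond_ratio_bounds AB.1 AB.2 (hw n)).
exists phi => //; exists (fun A B => l (A, B)) => [|A B]; last exact: (hl (A, B)).
split=> [B hB|A C B hCB].
  have hm n := mass_gt0 (hw (phi n)) hB.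
  split.
  - move=> A; apply: (Rle_cv_lim _ (Un_cv_const 0) (hl (A, B))) => n /=.
    by case: (cond_ratio_bounds A B (hw (phi n))).
  - apply: (UL_sequence _ _ _ (hl (setT, B))); apply: Un_cv_ext (Un_cv_const 1) => n /=.
    by rewrite /cond_ratio setTI; have := hm n => h; field; lra.
  - move=> A A' hAA'.
    apply: (UL_sequence _ _ _ (hl (A :|: A', B))); apply: Un_cv_ext (CV_plus _ _ _ _ (hl (A, B)) (hl (A', B))) => n /=.
    rewrite /cond_ratio setIUl massU; first by have := hm n => h; field; lra.
    by apply: disjointWl (subsetIl _ _) _; apply: disjointWr (subsetIl _ _) _.
  - apply: (UL_sequence _ _ _ (hl (B, B))); apply: Un_cv_ext (Un_cv_const 1) => n /=.
    by rewrite /cond_ratio setIid; have := hm n => h; field; lra.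
apply: (UL_sequence _ _ _ (hl (A :&: C, B))).
apply: Un_cv_ext (CV_mult _ _ _ _ (hl (A, C :&: B)) (hl (C, B))) => n /=.
have h1 := mass_gt0 (hw (phi n)) hCB.
have h2 : 0 < mass (w (phi n)) B by apply: Rlt_le_trans h1 _; apply: mass_le => //; exact: subsetIr.
by rewrite /cond_ratio setIA; field; lra.
Qed.

Section Rules.
Variable P : {set Om} -> {set Om} -> R.
Hypothesis HP : full_cond_prob P.

Lemma fcp_ge0 A B : B != set0 -> 0 <= P A B.
Proof. by move=> /(proj1 HP)[]. Qed.

Lemma fcpU A A' B : B != set0 -> [disjoint A & A'] -> P (A :|: A') B = P A B + P A' B.
Proof. by move=> /(proj1 HP)[_ _ h _]; apply: h. Qed.

Lemma fcp_id B : B != set0 -> P B B = 1.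
Proof. by move=> /(proj1 HP)[]. Qed.

Lemma fcp0 B : B != set0 -> P set0 B = 0.
Proof.
move=> hB; have := fcpU hB (A := set0) (A' := set0); rewrite setU0 => h.
suff : P set0 B = P set0 B + P set0 B by lra.
by apply: h; rewrite -setI_eq0 set0I.
Qed.

Lemma fcp_chain A C B : C :&: B != set0 -> P (A :&: C) B = P A (C :&: B) * P C B.
Proof. exact: (proj2 HP). Qed.

Lemma fcpIr A B : B != set0 -> P (A :&: B) B = P A B.
Proof.
move=> hB; rewrite fcp_chain ?setIid // fcp_id //; lra.
Qed.

Lemma fcpID A C B : B != set0 -> P A B = P (A :&: C) B + P (A :\: C) B.
Proof. by move=> hB; rewrite -{1}(setID A C) fcpU // disjointID. Qed.

Lemma fcp_sum A B : B != set0 -> P A B = mass (fun z => P [set z] B) A.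
Proof.
move=> hB; move: {2}#|A| (leqnn #|A|) => m; elim: m A => [|m IH] A.
  by rewrite leqn0 cards_eq0 => /eqP ->; rewrite fcp0 // mass0.
case: (eqVneq A set0) => [-> _|/set0Pn[z hz] hm]; first by rewrite fcp0 // mass0.
have hd : [disjoint [set z] & A :\ z] by rewrite -setI_eq0; apply/eqP/setP=> y; rewrite !inE; case: eqP.
rewrite -(setD1K hz) fcpU // massU // (IH (A :\ z)).
  by rewrite {2}/mass big_set1.
by move: hm; rewrite (cardsD1 z A) hz.
Qed.

Lemma conv_mix (T : finType) (K : (T -> R) -> Prop) (A : T -> {set Om}) (cl : Om -> {set Om}) (E : {set Om}) :
  (forall p q (l : R), K p -> K q -> (0 <= l <= 1) -> K (fun a => l * p a + (1 - l) * q a)) ->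
  (forall p q, (forall a, p a = q a) -> K p -> K q) ->
  (forall z, z \in cl z) -> (forall z z', z' \in cl z -> cl z' = cl z) ->
  (forall z, z \in E -> cl z \subset E) -> (forall z, z \in E -> K (fun a => P (A a) (cl z))) ->
  E != set0 -> K (fun a => P (A a) E).
Proof.
move=> hconv hext hcl hcl'; move: {2}#|E| (leqnn #|E|) => m.
elim: m E => [|m IH] E; first by rewrite leqn0 cards_eq0 => /eqP ->; rewrite eqxx.
move=> hm hE hK hE0; have [z hz] := set0Pn _ hE0.
have hIz : cl z :&: E = cl z by apply/setIidPl; apply: hE.
have hclz : cl z != set0 by apply/set0Pn; exists z.
case: (eqVneq (E :\: cl z) set0) => [/eqP|hD0].
  rewrite setD_eq0 => h; have -> : E = cl z by apply/eqP; rewrite eqEsubset h hE.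
  exact: hK.
have hID : (E :\: cl z) :&: E = E :\: cl z by apply/setIidPl; exact: subsetDl.
have h1 := fcpID E (cl z) hE0; rewrite fcp_id // setIC hIz in h1.
have h2 := fcp_ge0 (cl z) hE0; have h3 := fcp_ge0 (E :\: cl z) hE0.
apply: (hext (fun a => P (cl z) E * P (A a) (cl z) + (1 - P (cl z) E) * P (A a) (E :\: cl z))).
  move=> a; rewrite -(fcpIr (A a) hE0) (fcpID (A a :&: E) (cl z) hE0).
  rewrite -setIA [E :&: _]setIC hIz fcp_chain ?hIz //.
  rewrite -setIDA fcp_chain ?hID //.
  have -> : P (E :\: cl z) E = 1 - P (cl z) E by lra.
  lra.
apply: hconv; [exact: hK | | lra].
apply: IH => //.
- have := cardsID (cl z) E; rewrite setIC hIz => h.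
  have : (0 < #|cl z|)%N by rewrite card_gt0; apply/set0Pn; exists z.
  move=> h4; rewrite -ltnS; apply: leq_trans hm; rewrite -h; by rewrite -[X in (X < _)%N]add0n ltn_add2r.
- move=> y; rewrite inE => /andP[hyz hyE]; rewrite subsetD hE //=.
  rewrite -setI_eq0; apply: contraNT hyz => /set0Pn[x]; rewrite inE => /andP[/hcl' h4 /hcl' h5].
  by rewrite -h5 h4.
- by move=> y; rewrite inE => /andP[_ /hK].
Qed.

(* Peel off the support of [P (. | D)] and weight the rest of [D] by an infinitesimal. *)
Lemma exists_layered_weights (D : {set Om}) : exists w : nat -> Om -> R,
  (forall n z, 0 < w n z) /\
  forall A B, B != set0 -> B \subset D -> Un_cv (fun n => cond_ratio (w n) A B) (P A B).
Proof.
move: {2}#|D| (leqnn #|D|) => m; elim: m D => [|m IH] D.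
  rewrite leqn0 cards_eq0 => /eqP ->; exists (fun _ _ => 1); split; first by move=> *; lra.
  by move=> A B hB; rewrite subset0 (negbTE hB).
case: (eqVneq D set0) => [-> _|hD hm].
  exists (fun _ _ => 1); split; first by move=> *; lra.
  by move=> A B hB; rewrite subset0 (negbTE hB).
pose q z := P [set z] D.
pose pos z := if Rlt_dec 0 (q z) then true else false.
have posP z : reflect (0 < q z) (pos z) by rewrite /pos; case: Rlt_dec => h; constructor.
have qge z : 0 <= q z by apply: fcp_ge0.
pose T := [set z in D | pos z].
have hTD : T \subset D by apply/subsetP=> z; rewrite inE => /andP[].
have hT : T != set0.
  apply/negP=> /eqP hT; have := fcp_id hD; rewrite fcp_sum // /mass big1; first by lra.
  move=> z hz; have : z \notin T by rewrite hT inE.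
  rewrite inE hz /= => /posP; have := qge z; rewrite /q; lra.
have [|w' [hw' hcv]] := IH (D :\: T).
  rewrite -ltnS; apply: leq_trans hm; apply: proper_card; apply/properP; split; first exact: subsetDl.
  case/set0Pn: hT => z hz; exists z; first exact: (subsetP hTD).
  by rewrite inE hz.
pose c n := RinvN n / mass (w' n) setT.
have hset : [set: Om] != set0 by apply: contraNneq hD => h; rewrite -subset0 -h subsetT.
have hc n : 0 < c n by apply: Rdiv_lt_0_compat; [exact: cond_pos | exact: mass_gt0].
pose w n z := if z \in T then q z else c n * w' n z.
have hw n z : 0 < w n z.
  rewrite /w; case: ifP => [|_]; last exact: Rmult_lt_0_compat.
  by rewrite inE => /andP[_ /posP].
exists w; split=> // A B hB hBD.
have hcT z : z \in D -> Un_cv (fun n => w n z) (q z).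
  move=> hz; case: (boolP (z \in T)) => hzT.
    by apply: Un_cv_ext (Un_cv_const _) => n; rewrite /w hzT.
  apply: (@Un_cv_ext (fun n => c n * w' n z)) => [n|]; first by rewrite /w (negbTE hzT).
  have -> : q z = 0 by move: hzT; rewrite inE hz /= => /posP; have := qge z; lra.
  move=> eps heps; have [N hN] := RinvN_cv heps; exists N => n /hN.
  rewrite /Rdist !Rminus_0_r; rewrite Rabs_pos_eq; last exact/Rlt_le/cond_pos.
  rewrite Rabs_pos_eq; last by apply/Rlt_le/Rmult_lt_0_compat.
  apply: Rle_lt_trans; rewrite /c.
  have h1 := mass_gt0 (hw' n) hset.
  have := mass_le (hw' n) (subsetT [set z]); rewrite {1}/mass big_set1 => h2.
  have h3 := cond_pos (RinvN n).
  apply: (Rmult_le_reg_r (mass (w' n) setT)) => //.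
  have -> : RinvN n / mass (w' n) setT * w' n z * mass (w' n) setT = RinvN n * w' n z by field; lra.
  by apply: Rmult_le_compat_l => //; lra.
have hmass (E : {set Om}) : E \subset D -> Un_cv (fun n => mass (w n) E) (P E D).
  move=> hE; rewrite (fcp_sum _ hD) /mass.
  have H (s : seq Om) : Un_cv (fun n => \big[Rplus/0]_(z <- s | z \in E) w n z) (\big[Rplus/0]_(z <- s | z \in E) q z).
    elim: s => [|z s IHs].
      by rewrite big_nil; apply: Un_cv_ext (Un_cv_const 0) => n; rewrite big_nil.
    rewrite big_cons; case: ifP => hz; last by apply: Un_cv_ext IHs => n; rewrite big_cons hz.
    apply: Un_cv_ext (CV_plus _ _ _ _ (hcT z (subsetP hE z hz)) IHs) => n.
    by rewrite big_cons hz.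
  exact: H.
case: (boolP (B \subset D :\: T)) => [hBT|/subsetPn[z hzB hzT]].
  apply: Un_cv_ext (hcv A B hB hBT) => n.
  have h (E : {set Om}) : E \subset B -> mass (w n) E = c n * mass (w' n) E.
    move=> hE; rewrite /mass big_distrr /=; apply: eq_bigr => z hz.
    have := subsetP (subset_trans hE hBT) z hz; rewrite inE /w => /andP[/negbTE -> _]. by [].
  rewrite /cond_ratio !h ?subsetIr //.
  have h1 := mass_gt0 (hw' n) hB; have h2 := hc n.
  by field; split; lra.
have hPB : 0 < P B D.
  have hq : 0 < q z.
    by move: hzT; rewrite !inE (subsetP hBD _ hzB) andbT negbK => /posP.
  rewrite fcp_sum // /mass (bigD1 z) //=; apply: Rplus_lt_le_0_compat => //.
  by apply: sum_ge0 => y _; apply: qge.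
have hBDI : B :&: D = B by apply/setIidPl.
have -> : P A B = P (A :&: B) D / P B D.
  by rewrite fcp_chain ?hBDI //; field; lra.
apply: Un_cv_div; [lra | apply: hmass | exact: hmass].
exact: subset_trans (subsetIr _ _) hBD.
Qed.

End Rules.
End FullConditional.

(** * Grafting *)

Section Configurations.
Variables (G : finType) (X : G -> finType).
Local Notation Om := (Omega X).
Implicit Types (w : Om -> R) (A B F : {set Om}) (S : {set G}) (z : Om).

Definition agree S z : {set Om} := [set z' : Om | [forall t, (t \in S) ==> (z' t == z t)]].

Lemma agreeP S z z' : reflect (forall t, t \in S -> z' t = z t) (z' \in agree S z).
Proof.
rewrite inE; apply: (iffP forallP) => h t; first by move=> ht; have := h t; rewrite ht => /eqP.
by apply/implyP => /h ->.
Qed.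

Lemma agree_refl S z : z \in agree S z.
Proof. exact/agreeP. Qed.

Lemma agreeC S z z' : (z' \in agree S z) = (z \in agree S z').
Proof. by apply/agreeP/agreeP => h t /h. Qed.

Lemma agree_class S z z' : z' \in agree S z -> agree S z' = agree S z.
Proof.
move=> /agreeP h; apply/setP=> y; apply/agreeP/agreeP => h' t ht; rewrite h' ?h //.
Qed.

Lemma agreeT z : agree setT z = [set z].
Proof.
apply/setP=> y; rewrite in_set1; apply/agreeP/eqP => [h|-> //].
by apply/ffunP=> t; apply: h.
Qed.

Definition update z (t : G) (a : X t) : Om := [ffun s => dfwith z a s].

Lemma update_same z t a : update z a t = a :> X t.
Proof. by rewrite ffunE dfwith_in. Qed.

Lemma update_other z t (a : X t) s : s != t -> update z a s = z s.
Proof. by move=> h; rewrite ffunE dfwith_out // eq_sym. Qed.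

Lemma agree_update S z t (a : X t) : t \notin S ->
  agree (t |: S) (update z a) = [set z' : Om | z' t == a] :&: agree S z.
Proof.
move=> ht; apply/setP=> y; rewrite in_setI [y \in [set _ | _]]inE.
apply/agreeP/andP => [h|[/eqP h1 /agreeP h2] s].
  split; first by rewrite h ?setU11 // update_same.
  apply/agreeP=> s hs; rewrite h ?setU1r // update_other //.
  by apply: contraNneq ht => <-.
rewrite in_setU1; case: (eqVneq s t) => [-> _|hst /= hs]; first by rewrite update_same.
by rewrite update_other // h2.
Qed.

Lemma mass_agree_update w B S z t : t \notin S ->
  mass w (B :&: agree S z) =
  \big[Rplus/IZR 0]_(a : X t) mass w (B :&: agree (t |: S) (update z a)).
Proof.
move=> ht; rewrite /mass (partition_big (fun y : Om => y t) predT) //=.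
apply: eq_bigr => a _; apply: eq_bigl => y.
by rewrite agree_update // !in_setI -andbA; congr (_ && _); rewrite andbC; congr (_ && _); rewrite inE.
Qed.

Definition glue S (y z : Om) : Om := [ffun t => if t \in S then y t else z t].

Lemma glue_in S y z t : t \in S -> glue S y z t = y t.
Proof. by rewrite ffunE => ->. Qed.

Lemma glue_out S y z t : t \notin S -> glue S y z t = z t.
Proof. by rewrite ffunE => /negbTE ->. Qed.

Lemma sum_agree_const (h : Om -> R) S z1 z2 :
  (forall z z' : Om, (forall t, t \notin S -> z t = z' t) -> h z = h z') ->
  \big[Rplus/IZR 0]_(z in agree S z1) h z = \big[Rplus/IZR 0]_(z in agree S z2) h z.
Proof.
move=> hh; rewrite (reindex_onto (glue S z1) (glue S z2)) /=; last first.
  move=> z /agreeP hz; apply/ffunP => t; rewrite ffunE.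
  by case: ifPn => ht; [rewrite hz | rewrite glue_out].
apply: eq_big => [z|z _]; last by apply: hh => t ht; rewrite glue_out.
have -> : glue S z1 z \in agree S z1 by apply/agreeP=> t; exact: glue_in.
apply/eqP/agreeP => [<- t ht|hz]; first by rewrite glue_in.
apply/ffunP => t; rewrite ffunE.
by case: ifPn => ht; [rewrite hz | rewrite glue_out].
Qed.

Definition depends_on S F := forall z z', z' \in agree S z -> z \in F -> z' \in F.

Lemma depends_on_agree S F z z' : depends_on S F -> z' \in agree S z -> (z' \in F) = (z \in F).
Proof.
by move=> hF h; apply/idP/idP; apply: hF; rewrite // agreeC.
Qed.

Lemma depends_onS S S' F : S \subset S' -> depends_on S F -> depends_on S' F.
Proof.
by move=> h hF z z' /agreeP h'; apply: hF; apply/agreeP=> t /(subsetP h)/h'.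
Qed.

Lemma depends_onI S F F' : depends_on S F -> depends_on S F' -> depends_on S (F :&: F').
Proof.
move=> h h' z z' hz; rewrite !in_setI => /andP[h1 h2].
by rewrite (h z) // (h' z).
Qed.

Lemma depends_on_class S S' z : S \subset S' -> depends_on S' (agree S z).
Proof.
move=> hS; apply: (depends_onS hS) => y y' /agreeP h /agreeP h'.
by apply/agreeP=> t ht; rewrite h ?h'.
Qed.

Lemma proj_eq S z z' : (forall t, t \in S -> z t = z' t) -> proj S z = proj S z'.
Proof. by move=> h; apply/ffunP=> t; rewrite !ffunE h // (valP t). Qed.

Lemma depends_on_proj S (K : {set XS X S}) : depends_on S [set z : Om | proj S z \in K].
Proof.
by move=> z z' /agreeP h; rewrite !inE (proj_eq h).
Qed.

Lemma depends_on_meet S S' F F' : [disjoint S & S'] -> depends_on S F -> depends_on S' F' ->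
  F != set0 -> F' != set0 -> F :&: F' != set0.
Proof.
move=> hd hF hF' /set0Pn[y hy] /set0Pn[z hz]; apply/set0Pn; exists (glue S y z).
rewrite in_setI; apply/andP; split.
  by apply: hF hy; apply/agreeP=> t ht; rewrite glue_in.
by apply: hF' hz; apply/agreeP=> t ht; rewrite glue_out // (disjointFl hd).
Qed.

Lemma agree_neq0 S z : agree S z != set0.
Proof. by apply/set0Pn; exists z; apply: agree_refl. Qed.
End Configurations.

Section Grafting.
Variables (G : finType) (e : rel G) (X : G -> finType).
Hypothesis Hdag : dag e.
Local Notation Om := (Omega X).
Local Open Scope R_scope.

Variables (U V D : {set G}) (x : Om) (B1 : {set Om}) (p : Om -> R).
Variable l : G -> Om -> R.
Hypotheses (hUV : [disjoint U & V]) (hU : ancestral e U).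
Hypothesis hpar : forall q v, e q v -> v \in V -> (q \in V) || (q \in U).
Hypotheses (hD : D \subset U) (hB1 : depends_on U B1) (hB10 : B1 != set0).
Hypothesis hp : forall z, 0 < p z.
Hypothesis l_gt0 : forall t z, 0 < l t z.
Hypothesis l_local : forall t (z z' : Om), z' t = z t -> (forall q, e q t -> z' q = z q) -> l t z' = l t z.
Hypothesis l_sum : forall t z, \big[Rplus/0]_(a : X t) l t (update z a) = 1.

(* The nodes of [V] that still follow [p]: those with no ancestor in [D] deviating from [x]. *)
Definition core (z : Om) : {set G} :=
  [set v in V | ~~ [exists c in D, (z c != x c) && sqsub e c v]].

Definition core_mass (W : {set G}) (z : Om) := mass p (B1 :&: agree W z).

Definition graft_on (A : {set G}) (z : Om) :=
  core_mass (A :&: core z) z * \big[Rmult/1]_(t in A :\: core z) l t z.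

Definition graft (z : Om) := graft_on setT z.

Lemma coreV z : core z \subset V.
Proof. by apply/subsetP=> v; rewrite inE => /andP[]. Qed.

Lemma core_mass_gt0 (W : {set G}) z : W \subset V -> 0 < core_mass W z.
Proof.
move=> hW; apply: mass_gt0 => //.
exact: depends_on_meet hUV hB1 (depends_on_class hW) hB10 (agree_neq0 _ _).
Qed.

Lemma graft_on_gt0 A z : 0 < graft_on A z.
Proof.
apply: Rmult_lt_0_compat; last exact: prod_gt0.
by apply: core_mass_gt0; apply: subset_trans (subsetIr _ _) (coreV z).
Qed.

Section Step.
Variables (A : {set G}) (t : G).
Hypotheses (hA : ancestral e A) (htA : t \notin A) (hpt : forall q, e q t -> q \in A).

Lemma ancestral_setU1 : ancestral e (t |: A).
Proof.
move=> q s hqs; rewrite !in_setU1 => /orP[/eqP hst|hs]; first by rewrite hpt ?orbT // -hst.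
by rewrite (hA hqs hs) orbT.
Qed.

Lemma core_update z (a : X t) v : v \in t |: A -> (v \in core (update z a)) = (v \in core z).
Proof.
move=> hv; rewrite !inE; congr (_ && ~~ _); apply: eq_existsb => c.
case hcv: (sqsub e c v); rewrite ?andbF // update_other //.
apply: contraTneq hv => hct; rewrite in_setU1 negb_or; apply/andP; split.
  by apply: contraTneq hcv => ->; rewrite hct; apply: Hdag.
apply: contra htA; rewrite -hct; exact: (ancestral_connect hA (sqsub_connect hcv)).
Qed.

Lemma core_mass_agree W z z' : z' \in agree W z -> core_mass W z' = core_mass W z.
Proof. by move=> h; rewrite /core_mass (agree_class h). Qed.

Lemma graft_on_step z (a : X t) : graft_on (t |: A) (update z a) =
  (if t \in core z then core_mass (t |: (A :&: core z)) (update z a)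
   else core_mass (A :&: core z) z * l t (update z a))
  * \big[Rmult/1]_(s in A :\: core z) l s z.
Proof.
have hl s : s \in A -> l s (update z a) = l s z.
  move=> hs; apply: l_local => [|q hq]; apply: update_other; apply: contraNneq htA => <- //.
  exact: hA hq hs.
have hI : (t |: A) :&: core (update z a) = (t |: A) :&: core z.
  apply/setP=> v; rewrite !in_setI; case hv: (v \in t |: A) => //=; exact: core_update.
have hDf : (t |: A) :\: core (update z a) = (t |: A) :\: core z.
  apply/setP=> v; rewrite !in_setD; case hv: (v \in t |: A); rewrite ?andbF //.
  by rewrite core_update.
have hprod : \big[Rmult/1]_(s in A :\: core z) l s (update z a) =
             \big[Rmult/1]_(s in A :\: core z) l s z.
  by apply: eq_bigr => s; rewrite in_setD => /andP[_ /hl].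
rewrite /graft_on hI hDf; case: ifPn => ht.
  have -> : (t |: A) :\: core z = A :\: core z.
    by apply/setP=> v; rewrite !in_setD in_setU1; case: eqP => // ->; rewrite ht.
  rewrite hprod; congr (core_mass _ _ * _).
  by apply/setP=> v; rewrite !in_setI !in_setU1 in_setI; case: eqP => // ->; rewrite ht.
have -> : (t |: A) :&: core z = A :&: core z.
  by apply/setP=> v; rewrite !in_setI in_setU1; case: eqP => // ->; rewrite (negbTE ht) !andbF.
have -> : (t |: A) :\: core z = t |: (A :\: core z).
  by apply/setP=> v; rewrite in_setD !in_setU1 in_setD; case: eqP => // ->; rewrite ht.
rewrite big_setU1 /=; last by rewrite in_setD (negbTE htA) andbF.
rewrite hprod (@core_mass_agree (A :&: core z) z); first by rewrite Rmult_assoc.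
apply/agreeP=> s; rewrite in_setI => /andP[hs _]; apply: update_other.
by apply: contraNneq htA => <-.
Qed.

Lemma graft_on_marginal z :
  \big[Rplus/0]_(a : X t) graft_on (t |: A) (update z a) = graft_on A z.
Proof.
under eq_bigr do rewrite graft_on_step.
rewrite -big_distrl /= /graft_on; congr (_ * _); case: (boolP (t \in core z)) => ht.
  have htI : t \notin A :&: core z by rewrite in_setI (negbTE htA).
  by rewrite /core_mass (mass_agree_update _ _ _ htI).
by rewrite -big_distrr /= l_sum Rmult_1_r.
Qed.
End Step.

Lemma mass_graft_agree A z : ancestral e A -> mass graft (agree A z) = graft_on A z.
Proof.
move: {2}#|~: A| (leqnn #|~: A|) => m; elim: m A z => [|m IH] A z.
  rewrite leqn0 cards_eq0 => /eqP h _; have -> : A = setT by rewrite -(setCK A) h setC0.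
  by rewrite agreeT /mass big_set1.
move=> hm hA; case: (eqVneq A setT) => [->|hAT]; first by rewrite agreeT /mass big_set1.
have [t [htA hpt]] := ancestral_extension Hdag hA hAT.
rewrite -(graft_on_marginal hA htA z) -[agree A z]setTI (mass_agree_update _ _ _ htA).
apply: eq_bigr => a _; rewrite setTI IH //; last exact: ancestral_setU1.
rewrite -ltnS; apply: leq_trans hm; apply: proper_card; rewrite properC; apply/properP.
by split; [exact: subsetUr | exists t; rewrite ?setU11].
Qed.

Lemma cond_graft s z (a : X s) :
  cond_ratio graft [set y : Om | y s == a] (agree (nondesc e s) z) =
  if s \in core z then cond_ratio p [set y : Om | y s == a] (B1 :&: agree (nondesc e s :&: core z) z)
  else l s (update z a).
Proof.
have hs : s \notin nondesc e s by rewrite !inE eqxx.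
have hA : ancestral e (nondesc e s) by exact: nondesc_ancestral.
have hpt q : e q s -> q \in nondesc e s by apply: par_nondesc.
rewrite /cond_ratio -agree_update // !mass_graft_agree //; last exact: ancestral_setU1.
rewrite graft_on_step //.
have h1 : 0 < \big[Rmult/1]_(t in nondesc e s :\: core z) l t z by apply: prod_gt0.
have h2 : 0 < core_mass (nondesc e s :&: core z) z.
  by apply: core_mass_gt0; apply: subset_trans (subsetIr _ _) (coreV z).
rewrite /graft_on; case: ifP => hc; last by field; lra.
have -> : [set y : Om | y s == a] :&: (B1 :&: agree (nondesc e s :&: core z) z) =
  B1 :&: agree (s |: (nondesc e s :&: core z)) (update z a).
  by rewrite setICA agree_update // in_setI (negbTE hs).
rewrite -/(core_mass _ _) -/(core_mass _ _); field; lra.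
Qed.

Variable B2 : {set Om}.
Hypotheses (hB2 : depends_on U B2) (hB20 : B2 != set0).
Hypothesis hB2x : forall (z : Om) c, z \in B2 -> c \in D -> z c = x c.

Lemma ancestral_UV : ancestral e (U :|: V).
Proof.
move=> q v hqv; rewrite !in_setU => /orP[/(hU hqv) -> //|/(hpar hqv)].
by rewrite orbC.
Qed.

Lemma mass_graft_factor : exists2 k, 0 < k
  & forall F, depends_on V F -> mass graft (F :&: B2) = k * mass p (F :&: B1).
Proof.
have [z0 hz0] := set0Pn _ hB20.
pose g z := \big[Rmult/1]_(t in U) l t z.
pose N := \big[Rplus/0]_(z in agree (U :|: V) z0) 1.
pose kap := \big[Rplus/0]_(z in agree V z0) (if z \in B2 then g z else 0).
have hg z : 0 < g z by apply: prod_gt0.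
have hN : 0 < N by apply: (sum_gt0 (agree_refl _ z0)) => *; lra.
have hkap : 0 < kap.
  rewrite /kap (bigD1 z0) ?agree_refl //= hz0; apply: Rplus_lt_le_0_compat => //.
  by apply: sum_ge0 => z _; case: ifP => _; [apply/Rlt_le | lra].
exists (kap / N); first exact: Rdiv_lt_0_compat.
move=> F hF.
have hE : depends_on (U :|: V) (F :&: B2).
  apply: depends_onI; first exact: depends_onS (subsetUr _ _) hF.
  exact: depends_onS (subsetUl _ _) hB2.
have h1 : \big[Rplus/0]_(z in F :&: B2) graft_on (U :|: V) z = N * mass graft (F :&: B2).
  under eq_bigr do rewrite -(mass_graft_agree _ ancestral_UV).
  rewrite /mass (exchange_big_dep (fun y : Om => y \in F :&: B2)) /=; last first.
    by move=> i j hi hj; rewrite (depends_on_agree hE hj).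
  rewrite big_distrr /=; apply: eq_bigr => z hz.
  rewrite -[graft z in LHS]Rmult_1_l -big_distrl /=; congr (_ * _).
  rewrite /N (sum_agree_const z0 z) //; apply: eq_bigl => y.
  rewrite agreeC andbC; case hy: (z \in agree (U :|: V) y) => //=.
  by rewrite -(depends_on_agree hE hy).
have h2 : \big[Rplus/0]_(z in F :&: B2) graft_on (U :|: V) z = kap * mass p (F :&: B1).
  transitivity (\big[Rplus/0]_(z in F :&: B2) \big[Rplus/0]_(y in B1 :&: agree V z) (p y * g z)).
    apply: eq_bigr => z; rewrite in_setI => /andP[_ hz].
    have hcore : core z = V.
      apply/setP=> v; rewrite inE; case: (v \in V) => //=; apply/existsPn => c.
      by rewrite negb_and; case hc: (c \in D) => //=; rewrite (hB2x hz hc) eqxx.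
    rewrite /graft_on hcore -big_distrl /=; congr (core_mass _ _ * _).
      by apply/setP=> v; rewrite in_setI in_setU; case: (v \in V); rewrite ?orbT ?andbF.
    apply: eq_bigl => t; rewrite in_setD in_setU.
    case: (boolP (t \in U)) => ht; first by rewrite (disjointFr hUV ht).
    by case: (t \in V).
  rewrite (exchange_big_dep (fun y : Om => y \in F :&: B1)) /=; last first.
    move=> z y; rewrite !in_setI => /andP[hz _] /andP[-> hy].
    by rewrite (depends_on_agree hF hy) hz.
  rewrite /mass big_distrr /=; apply: eq_bigr => y; rewrite in_setI => /andP[hyF hyB].
  rewrite -big_distrr /= Rmult_comm; congr (_ * _).
  rewrite /kap (sum_agree_const z0 y); last first.
    move=> z z' hzz; have hag : z' \in agree U z.
      by apply/agreeP=> t ht; rewrite hzz // (disjointFr hUV ht).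
    rewrite (depends_on_agree hB2 hag); case: ifP => // _.
    apply: eq_bigr => t ht; apply: l_local => [|q hq]; move/agreeP: hag => hag; rewrite hag //.
    exact: hU hq ht.
  rewrite -big_mkcondr /=; apply: eq_bigl => z.
  rewrite !in_setI hyB /= (agreeC V z y); case hz: (z \in agree V y); rewrite ?andbF //= andbT.
  by rewrite (depends_on_agree hF hz) hyF.
have -> : kap / N * mass p (F :&: B1) = kap * mass p (F :&: B1) / N by field; lra.
by rewrite -h2 h1; field; lra.
Qed.
End Grafting.

Section Transfer.
Variables (G : finType) (e : rel G) (X : G -> finType).
Local Notation Om := (Omega X).
Local Open Scope R_scope.
Hypothesis HX : forall s, (0 < #|X s|)%N.
Hypothesis Hdag : dag e.
Variable M : forall s : G, XS X (par e s) -> (X s -> R) -> Prop.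
Hypothesis HM : local_models M.

Lemma proj_surj S (y : XS X S) : exists z : Om, proj S z = y.
Proof.
have d t : X t by apply: (enum_val (Ordinal (HX t))).
pose z : Om := [ffun t => if Sumbool.sumbool_of_bool (t \in S) is left h then y (exist _ t h) else d t].
exists z; apply/ffunP=> -[t ht]; rewrite !ffunE /=.
by case: Sumbool.sumbool_of_bool => [h|]; [rewrite (bool_irrelevance h ht) | rewrite ht].
Qed.

Lemma sum_const (T : finType) c : \big[Rplus/0]_(a : T) c = INR #|T| * c.
Proof.
rewrite big_const; elim: #|T| => [|n IH]; first by rewrite /= Rmult_0_l.
by rewrite iterS IH S_INR; lra.
Qed.

Lemma credal_ext (T : finType) (K : (T -> R) -> Prop) p q :
  credal_set K -> (forall a, p a = q a) -> K p -> K q.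
Proof.
move=> [_ _ _ hK] hpq hp; apply: (hK (fun=> p)) => // a.
by rewrite -hpq; apply: Un_cv_const.
Qed.

Lemma local_choice : exists loc : forall s, XS X (par e s) -> X s -> R, forall s y, M y (loc s y).
Proof.
have h s (y : XS X (par e s)) : exists p, M y p by case: (HM y).
exists (fun s y => proj1_sig (constructive_indefinite_description _ (h s y))) => s y.
by case: constructive_indefinite_description.
Qed.

Variables (U V D : {set G}) (x : Om) (P : {set Om} -> {set Om} -> R).
Hypotheses (hUV : [disjoint U & V]) (hU : ancestral e U) (hD : D \subset U).
Hypothesis hpar : forall q v, e q v -> v \in V -> (q \in V) || (q \in D).
Hypothesis HP : F_irr M P.

(* All states in the conditioning event agree with [z] on the parents of [s], so the
   conditional is a mixture of elements of a single local model. *)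
Lemma core_conditional (B : {set Om}) s z :
  depends_on U B -> B != set0 -> (forall (z : Om) c, z \in B -> c \in D -> z c = x c) ->
  s \in core e V D x z ->
  M (proj (par e s) z)
    (fun a => P [set y : Om | y s == a] (B :&: agree (nondesc e s :&: core e V D x z) z)).
Proof.
move=> hB hB0 hBx hs; have sV : s \in V by move: hs; rewrite inE => /andP[].
have [HPf HPloc] := HP; have [_ _ hconv _] := HM (proj (par e s) z).
have hUs : U \subset nondesc e s.
  apply/subsetP=> t ht; rewrite !inE negb_or; apply/andP; split.
    by apply: contraTneq ht => ->; rewrite (disjointFl hUV).
  apply/negP => /sqsub_connect hc; have := ancestral_connect hU hc ht.
  by rewrite (disjointFl hUV).
apply: (conv_mix HPf (cl := agree (nondesc e s))).
- exact: hconv.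
- by move=> p q; apply: credal_ext.
- exact: agree_refl.
- by move=> y y'; apply: agree_class.
- move=> y; rewrite in_setI => /andP[hyB /agreeP hy]; apply/subsetP=> y' /agreeP hy'.
  rewrite in_setI; apply/andP; split.
    by apply: hB hyB; apply/agreeP=> t /(subsetP hUs)/hy'.
  apply/agreeP=> t ht; rewrite hy' ?hy //.
  by move: ht; rewrite in_setI => /andP[].
- move=> y; rewrite in_setI => /andP[hyB /agreeP hy].
  have -> : proj (par e s) z = proj (par e s) y; last exact: HPloc.
  apply: proj_eq => t; rewrite inE => hts.
  case/orP: (hpar hts sV) => ht; last first.
    rewrite (hBx y t) //; apply/eqP/negPn/negP => hne; move: hs; rewrite inE sV /=.
    by case/negP; apply/existsP; exists t; rewrite ht hne edge_sqsub.
  rewrite hy // in_setI (par_nondesc Hdag hts) /= inE ht /=.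
  apply/negP=> /existsP[c /and3P[hc hne hct]]; move: hs; rewrite inE sV /=; case/negP.
  by apply/existsP; exists c; rewrite hc hne (connect_sqsub_trans hct (connect1 hts)).
- apply: depends_on_meet hUV hB (depends_on_class _) hB0 (agree_neq0 _ _).
  exact: subset_trans (subsetIr _ _) (coreV _ _ _ _ _).
Qed.

Variables B1 B2 : {set Om}.
Hypotheses (hB1 : depends_on U B1) (hB2 : depends_on U B2) (hB10 : B1 != set0) (hB20 : B2 != set0).
Hypothesis hB1x : forall (z : Om) c, z \in B1 -> c \in D -> z c = x c.
Hypothesis hB2x : forall (z : Om) c, z \in B2 -> c \in D -> z c = x c.

Lemma F_irr_transfer : exists2 P', F_irr M P' & forall A F, depends_on V A -> depends_on V F ->
  F != set0 -> P' A (F :&: B2) = P A (F :&: B1).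
Proof.
have [HPf HPloc] := HP.
have [p [hp hpP]] := exists_layered_weights HPf setT.
have [loc hloc] := local_choice.
have hpmf s y : is_pmf (loc s y) by case: (HM y) => h _ _ _; apply: h.
pose l n t (z : Om) := (1 - RinvN n) * loc t (proj (par e t) z) (z t) + RinvN n / INR #|X t|.
have hr n : 0 < RinvN n <= 1.
  split; first exact: cond_pos.
  rewrite /= -[X in _ <= X]Rinv_1; apply: Rinv_le_contravar; first lra.
  by have := pos_INR n; lra.
have hcard t : 0 < INR #|X t| by apply: lt_0_INR; apply/ltP.
have l_gt0 n t z : 0 < l n t z.
  have [h1 h2] := hr n; have [h3 _] := hpmf t (proj (par e t) z).
  apply: Rplus_le_lt_0_compat; last exact: Rdiv_lt_0_compat.
  by apply: Rmult_le_pos; [lra | exact: h3].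
have l_local n t (z z' : Om) : z' t = z t -> (forall q, e q t -> z' q = z q) -> l n t z' = l n t z.
  move=> ht hq; rewrite /l ht; congr (_ * loc _ _ _ + _).
  by apply: proj_eq => q; rewrite inE; apply: hq.
have proj_update t z (a : X t) : proj (par e t) (update z a) = proj (par e t) z.
  apply: proj_eq => q; rewrite inE => hq; apply: update_other.
  by apply: contraTneq hq => ->; apply/negP => /edge_sqsub; apply/negP.
have l_sum n t z : \big[Rplus/0]_(a : X t) l n t (update z a) = 1.
  rewrite /l; under eq_bigr do rewrite proj_update update_same.
  rewrite big_split /= -big_distrr /= (proj2 (hpmf _ _)) sum_const.
  have cancel r c : 0 < c -> (1 - r) * 1 + c * (r / c) = 1 by move=> hc; field; lra.
  exact: cancel (hcard t).
have hpar' q v : e q v -> v \in V -> (q \in V) || (q \in U).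
  by move=> h /(hpar h) /orP[->//|/(subsetP hD) ->]; rewrite orbT.
pose w n := graft e V D x B1 (p n) (l n).
have hw n z : 0 < w n z by exact: (graft_on_gt0 e D x hUV hB1 hB10 (hp n) (l_gt0 n) setT z).
have [phi hphi [P' hP' hcv]] := exists_full_cond_limit hw.
have hcvp (A B : {set Om}) : B != set0 -> Un_cv (fun n => cond_ratio (p (phi n)) A B) (P A B).
  move=> hB; exact: (Un_cv_reindex hphi (hpP A B hB (subsetT B))).
exists P'; first split=> // s z.
  have hcg n a := cond_graft Hdag D x hUV hB1 hB10 (hp n) (l_gt0 n) (l_local n) (l_sum n) z a.
  case: (boolP (s \in core e V D x z)) => hs.
    apply: (credal_ext (HM _) _ (core_conditional hB1 hB10 hB1x hs)) => a.
    apply: (UL_sequence _ _ _ _ (hcv _ _)).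
    apply: Un_cv_ext (hcvp _ _ _) => [n|]; first by rewrite hcg hs.
    apply: depends_on_meet hUV hB1 (depends_on_class _) hB10 (agree_neq0 _ _).
    exact: subset_trans (subsetIr _ _) (coreV _ _ _ _ _).
  apply: (credal_ext (HM _) _ (hloc _ _)) => a.
  apply: (UL_sequence _ _ _ _ (hcv _ _)).
  apply: (@Un_cv_ext (fun n => l (phi n) s (update z a))) => [n|]; first by rewrite hcg (negbTE hs).
  rewrite /l proj_update update_same.
  set q := loc _ _ a; have hq : (1 - 0) * q + 0 * / INR #|X s| = q by lra.
  rewrite -[X in Un_cv _ X]hq.
  have hr0 := Un_cv_reindex hphi RinvN_cv.
  apply: (CV_plus _ _ _ _ _ (CV_mult _ _ _ _ hr0 (Un_cv_const _))).
  exact: (CV_mult _ _ _ _ (CV_minus _ _ _ _ (Un_cv_const 1) hr0) (Un_cv_const q)).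
move=> A F hA hF hF0.
have hFB : F :&: B1 != set0 by rewrite setIC; apply: depends_on_meet hUV hB1 hF hB10 hF0.
apply: (UL_sequence _ _ _ (hcv _ _)); apply: Un_cv_ext (hcvp A _ hFB) => n.
have [k hk hkm] := mass_graft_factor Hdag B1 (p (phi n)) hUV hU hpar' (l_gt0 (phi n)) 
  (l_local (phi n)) (l_sum (phi n)) hB2 hB20 hB2x.
rewrite /cond_ratio !setIA !hkm //; last exact: depends_onI.
by have h := mass_gt0 (hp (phi n)) hFB; field; lra.
Qed.
End Transfer.

Theorem theorem5 (G : finType) (e : rel G) (X : G -> finType)
  (HX : forall s : G, 0 < #|X s|)
  (Hdag : dag e)
  (M : forall s : G, XS X (par e s) -> (X s -> R) -> Prop)
  (HM : local_models M)
  (I S C : {set G})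
  (HIS : [disjoint I & S]) (HIC : [disjoint I & C]) (HSC : [disjoint S & C])
  (Hsep : AD_separated e C I S) :
  forall (f : XS X S -> R) (BS : {set XS X S}) (xC : XS X C) (BI : {set XS X I}),
    BS != set0 -> BI != set0 ->
    lowerE M f (cond3 BS xC BI) = lowerE M f (cond2 BS xC).
Proof.
move=> f BS xC BI hBS hBI.
have [U [V [[hUV hU hpar hIU hSV] hCUV]]] := AD_separated_split Hdag HIC HSC Hsep.
have [x hx] := proj_surj HX xC.
pose F := [set z : Omega X | proj S z \in BS] :&: agree (C :&: V) x.
pose B1 := agree (C :&: U) x; pose B2 := [set z : Omega X | proj I z \in BI] :&: B1.
have proj_neq0 (T : {set G}) (K : {set XS X T}) : K != set0 ->
    [set z : Omega X | proj T z \in K] != set0.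
  case/set0Pn=> y hy; have [z hz] := proj_surj HX y.
  by apply/set0Pn; exists z; rewrite inE hz.
have hF : depends_on V F.
  apply: depends_onI; first exact: depends_onS hSV (@depends_on_proj _ _ _ _).
  exact/depends_on_class/subsetIr.
have hB1 : depends_on U B1 by exact/depends_on_class/subsetIr.
have hB2 : depends_on U B2.
  by apply: depends_onI => //; exact: depends_onS hIU (@depends_on_proj _ _ _ _).
have hF0 : F != set0.
  apply: (depends_on_meet HSC (@depends_on_proj _ _ _ _)) (proj_neq0 _ _ hBS) (agree_neq0 _ _).
  exact/depends_on_class/subsetIl.
have hB10 : B1 != set0 by exact: agree_neq0.
have hB20 : B2 != set0.
  apply: (depends_on_meet HIC (@depends_on_proj _ _ _ _)) (proj_neq0 _ _ hBI) (agree_neq0 _ _).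
  exact/depends_on_class/subsetIl.
have hB1x (z : Omega X) c : z \in B1 -> c \in C :&: U -> z c = x c by move=> /agreeP; apply.
have hB2x (z : Omega X) c : z \in B2 -> c \in C :&: U -> z c = x c.
  by rewrite [z \in B2]in_setI => /andP[_]; apply: hB1x.
have hCx (z : Omega X) : (proj C z == xC) = (z \in agree (C :&: V) x) && (z \in B1).
  rewrite -hx; apply/idP/andP => [/eqP h|[/agreeP h1 /agreeP h2]].
    have hz t : t \in C -> z t = x t.
      by move=> ht; have := congr1 (fun y : XS X C => y (exist _ t ht)) h; rewrite !ffunE.
    by split; apply/agreeP=> t; rewrite in_setI => /andP[/hz].
  apply/eqP/proj_eq => t ht; move/subsetP: hCUV => /(_ t ht); rewrite in_setU => /orP[hU'|hV'].
    by apply: h2; rewrite in_setI ht.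
  by apply: h1; rewrite in_setI ht.
have E2 : cond2 BS xC = F :&: B1.
  by apply/setP=> z; rewrite [LHS]inE hCx !in_setI inE andbA.
have E3 : cond3 BS xC BI = F :&: B2.
  apply/setP=> z; rewrite [LHS]inE hCx !in_setI [z \in [set _ | _]]inE.
  by rewrite [z \in [set z0 | proj I z0 \in BI]]inE -!andbA; do 2 congr (_ && _); rewrite andbC.
rewrite E2 E3 /lowerE; congr einf.
have hSy y : depends_on V [set z : Omega X | proj S z == y].
  by move=> z z' h; have := @depends_onS _ _ _ _ _ hSV (@depends_on_proj _ _ S [set y]) z z' h; rewrite !inE.
apply: functional_extensionality => r; apply: propositional_extensionality.
split=> -[P [HP ->]].
  have [P' HP' hP'] := F_irr_transfer HX Hdag HM hUV hU (subsetIr C U) hpar HP hB2 hB1 hB20 hB10 hB2x hB1x.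
  by exists P'; split=> //; apply: eq_bigr => y _; rewrite hP'.
have [P' HP' hP'] := F_irr_transfer HX Hdag HM hUV hU (subsetIr C U) hpar HP hB1 hB2 hB10 hB20 hB1x hB2x.
by exists P'; split=> //; apply: eq_bigr => y _; rewrite hP'.
Qed.
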